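(* For every positive rational number $r$ there exists $u\in\mathbb{N}$ such that \[ \frac{s_2(u^2)}{s_2(u)}=r. \]
   Context: For an integer $q\geq 2$ and $n\in\mathbb{N}$, $s_q(n)$ denotes the sum of the digits of $n$ written in base $q$; so $s_2(n)$ is the number of $1$s in the binary expansion of $n$. *)

(* Defs.v *)
From mathcomp Require Import all_boot all_order all_algebra.

Set Implicit Arguments.
Unset Strict Implicit.
Unset Printing Implicit Defensive.

(* The coefficient of q ^ i in the base-q expansion of n. *)
Definition digit (q n i : nat) : nat := (n %/ q ^ i) %% q.

(* s_q(n), for q >= 2: since n < q ^ n, all digits of index i >= n are 0. *)
Definition digit_sum (q n : nat) : nat := \sum_(i < n) digit q n i.

(* Main.v *)
Require Import Defs.
From mathcomp Require Import all_boot all_order all_algebra.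
From mathcomp Require Import ring zify.

Import Order.TTheory GRing.Theory Num.Theory.
Local Open Scope ring_scope.

(** Put X = 2^k, m = 2^c (c > 0) and t = m X^4 + m X^3 - X^2 + m X + m. The negative
    coefficient produces a run of k + c ones, so s(t) = k + c + 3, whereas t^2
    and t (X + 1) have nonnegative coefficients, so that s(t^2) = 4 c + 4 and
    s(t (X + 1)) = 2 c + 4 do not depend on k once k is large. Adding n
    sufficiently spread out shifts of w = X + 1 to t increases s(t) by 2 n and
    s(t^2) by n (2 c + 4) + 3 n (n + 1) / 2. If r = a / b, the choice
    c = 2 a - 1, n = 2 a makes s(u^2) equal to a (14 a + 15), and the free
    parameter k is used to make s(u) equal to b (14 a + 15). *)

Section DigitSum.
Local Open Scope nat_scope.

Lemma digit_sum_ord q n N : 1 < q -> n <= N ->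
  digit_sum q n = \sum_(i < N) digit q n i.
Proof.
move=> q1 leN; rewrite /digit_sum -!(big_mkord xpredT (digit q n)).
rewrite [RHS](big_cat_nat (n := n)) //= -[LHS]addn0; congr (_ + _).
rewrite big_nat big1 // => i /andP[lei _].
by rewrite /digit divn_small ?mod0n // (leq_trans (ltn_expl n q1)) // leq_pexp2l // ltnW.
Qed.

Lemma digit_sum_rec q n : 1 < q ->
  digit_sum q n = n %% q + digit_sum q (n %/ q).
Proof.
move=> q1; rewrite (digit_sum_ord q n n.+1) // big_ord_recl /digit expn0 divn1.
rewrite (digit_sum_ord q (n %/ q) n) // ?leq_div //.
by congr (_ + _); apply: eq_bigr => i _; rewrite /digit expnS divnMA.
Qed.

(** As [x] fills only the lowest [N] places, the digit strings are concatenated without carry. The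
    induction strips the last digit of [x]. *)
Lemma digit_sumD q N x y : 1 < q -> x < q ^ N ->
  digit_sum q (x + q ^ N * y) = digit_sum q x + digit_sum q y.
Proof.
move=> q1; have q0 := ltnW q1; elim: N x => [|N IH] x.
  by rewrite ltnS leqn0 => /eqP ->; rewrite mul1n /digit_sum big_ord0.
rewrite expnS => ltx; rewrite digit_sum_rec // [in RHS]digit_sum_rec //.
have -> : x + q * q ^ N * y = q ^ N * y * q + x by ring.
rewrite modnMDl divnMDl // [_ + x %/ q]addnC IH ?addnA //.
by rewrite ltn_divLR // mulnC.
Qed.

Lemma digit_sum0 q : digit_sum q 0 = 0.
Proof. by rewrite /digit_sum big_ord0. Qed.

Lemma digit_sumMX q N y : 1 < q -> digit_sum q (q ^ N * y) = digit_sum q y.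
Proof.
move=> q1; have := digit_sumD q N 0 y q1; rewrite digit_sum0 !add0n; apply.
by rewrite expn_gt0 ltnW.
Qed.

Lemma digit_sum1 q : 1 < q -> digit_sum q 1 = 1.
Proof. by move=> q1; rewrite /digit_sum big_ord1 /digit expn0 divn1 modn_small. Qed.

Lemma digit_sumX q N : 1 < q -> digit_sum q (q ^ N) = 1.
Proof. by move=> q1; rewrite -(muln1 (q ^ N)) digit_sumMX // digit_sum1. Qed.

Lemma digit_sum2_predX c : digit_sum 2 (2 ^ c).-1 = c.
Proof.
elim: c => [|c IH]; first by rewrite digit_sum0.
have m0 : 0 < 2 ^ c by rewrite expn_gt0.
rewrite expnS (_ : (2 * 2 ^ c).-1 = 1 + 2 ^ 1 * (2 ^ c).-1); last by lia.
by rewrite digit_sumD // digit_sum1 // IH.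
Qed.

(** For a large shift, the three terms of (u + 2^M w)^2 occupy disjoint blocks of digits. The clause
    on [v * w] is what lets the step be iterated. *)
Lemma digit_sum2_adjoin u w : exists v,
  [/\ digit_sum 2 v = digit_sum 2 u + digit_sum 2 w,
      digit_sum 2 (v * w) = digit_sum 2 (u * w) + digit_sum 2 (w ^ 2) &
      digit_sum 2 (v ^ 2) =
        digit_sum 2 (u ^ 2) + digit_sum 2 (u * w) + digit_sum 2 (w ^ 2)].
Proof.
pose N := u ^ 2 + u * w.
have ltN x : x <= N -> x < 2 ^ N by move=> lex; apply: leq_ltn_trans lex (ltn_expl _ _).
have uw : u * w < 2 ^ N by apply: ltN; rewrite leq_addl.
have uu : u ^ 2 < 2 ^ N by apply: ltN; rewrite leq_addr.
have lt_u : u < 2 ^ N.+1 by rewrite expnS; nia.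
exists (u + 2 ^ N.+1 * w); split.
- by rewrite digit_sumD.
- rewrite (_ : _ * w = u * w + 2 ^ N.+1 * w ^ 2); last by ring.
  by rewrite digit_sumD // expnS; lia.
- rewrite (_ : _ ^ 2 = u ^ 2 + 2 ^ N.+2 * (u * w + 2 ^ N * w ^ 2)); last first.
    by rewrite !expnS; ring.
  by rewrite digit_sumD ?digit_sumD ?addnA // !expnS; lia.
Qed.

(** The i-th adjunction adds s(u w) + i s(w^2) to the digit sum of the square; the binomial is 1 +
    ... + n. *)
Lemma digit_sum2_adjoinn n u w : exists v,
  [/\ digit_sum 2 v = digit_sum 2 u + n * digit_sum 2 w,
      digit_sum 2 (v * w) = digit_sum 2 (u * w) + n * digit_sum 2 (w ^ 2) &
      digit_sum 2 (v ^ 2) =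
        digit_sum 2 (u ^ 2) + n * digit_sum 2 (u * w)
        + 'C(n.+1, 2) * digit_sum 2 (w ^ 2)].
Proof.
elim: n => [|n [v [v1 vw vv]]]; first by exists u; rewrite !mul0n !addn0.
have [v' [v1' vw' vv']] := digit_sum2_adjoin v w.
exists v'; rewrite v1' vw' vv' v1 vw vv (binS n.+1 1) bin1.
by split; lia.
Qed.

(** The bound on [k] says 8 m^2 <= X, so the coefficients of both products, at most 4 m^2 + 1, are
    digits in base X and their digit sums add up. *)
Lemma digit_sum2_seed c k : 0 < c -> 2 * c + 3 <= k -> exists t,
  [/\ digit_sum 2 t = k + c + 3,
      digit_sum 2 (t * (1 + 2 ^ k)) = 2 * c + 4 &
      digit_sum 2 (t ^ 2) = 4 * c + 4].
Proof.
(* From here [c] is one less than in the statement, and m - 2 = 2 q with q a run of [c] ones. *)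
case: c => // c _ lek; set X := 2 ^ k; pose q := (2 ^ c).-1; pose m := 2 ^ c.+1.
have mE : m = 2 * q.+1 by rewrite /m expnS prednK ?expn_gt0.
have ltX : 8 * m ^ 2 <= X.
  by rewrite /m -expnM -(expnD 2 3) leq_pexp2l //; lia.
have m1E : m.-1 = 2 * q + 1 by rewrite mE; lia.
have [ltm lt2m ltm1 ltmm] : [/\ m < X, 2 * m < X, m.-1 < X & m * m < X].
  by split; nia.
have [lt2mm ltmq lt2mm1 lt4mm] : [/\ 2 * (m * m) < X, m * (2 * q) < X,
    2 * (m * m.-1) < X & 1 + 2 ^ 2 * (m * m) < X].
  by split; nia.
have m1 : digit_sum 2 m.-1 = c.+1 by rewrite digit_sum2_predX.
have sm x : digit_sum 2 (m * x) = digit_sum 2 x by rewrite digit_sumMX.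
have s2 x : digit_sum 2 (2 * x) = digit_sum 2 x by rewrite (digit_sumMX 2 1).
have s1 : digit_sum 2 1 = 1 by rewrite digit_sum1.
have sX x y : x < X -> digit_sum 2 (x + X * y) = digit_sum 2 x + digit_sum 2 y.
  exact: digit_sumD.
have sm1 : digit_sum 2 m = 1 by rewrite digit_sumX.
have sd : digit_sum 2 (m * X).-1 = c.+1 + k by rewrite /m /X -expnD digit_sum2_predX.
have mX0 : 0 < m * X by rewrite muln_gt0 !expn_gt0.
(* The terms m X^3 - X^2 are grouped as X^2 (m X - 1), which avoids a negative coefficient. *)
exists (m + X * (m + X * ((m * X).-1 + m * X * X))).
set t := m + _.
have tE : t + X ^ 2 = m * (X ^ 4 + X ^ 3 + X + 1).
  rewrite /t -[in m * X * X](prednK mX0).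
  move: (prednK mX0); set d := _.-1 => dE.
  transitivity (m + X * m + X ^ 2 * (d.+1 + d.+1 * X)); first by ring.
  by rewrite dE; ring.
split.
- rewrite /t !sX ?sm1 //.
  (* The run of ones is longer than one base-X digit, so the split is made at 2^(c+1+k) = m X
     instead of X. *)
  have -> : (m * X).-1 + m * X * X = (m * X).-1 + 2 ^ (c.+1 + k) * X.
    by rewrite expnD.
  rewrite digit_sumD // ?sd ?digit_sumX //; first by lia.
  by rewrite expnD; move: mX0; rewrite /m /X; lia.
- have -> : t * (1 + X) =
    m + X * (2 * m + X * (m.-1 + X * (m.-1 + X * (2 * m + X * m)))).
    by apply: (@addIn (X ^ 2 * (1 + X))); rewrite -mulnDl tE m1E mE; ring.
  by rewrite !sX ?s2 ?sm1 ?m1 //; lia.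
- have -> : t ^ 2 =
    m * m + X * (2 * (m * m) + X * (m * (2 * q) + X * (2 * (m * m.-1) + X * (
    1 + 2 ^ 2 * (m * m) + X * (2 * (m * m.-1) + X * (m * (2 * q) + X * (
    2 * (m * m) + X * (m * m)))))))).
    (* Adding this term to t^2 gives (t + X^2)^2 + X^4, to which [tE] applies without
       subtraction. *)
    apply: (@addIn (2 * X ^ 2 * (t + X ^ 2))).
    transitivity ((t + X ^ 2) ^ 2 + X ^ 4); first by ring.
    by rewrite tE m1E mE; ring.
  rewrite !sX ?(digit_sumD 2 2 1) ?s1 ?s2 ?sm ?s2 ?sm1 ?m1 ?digit_sum2_predX //; lia.
Qed.

End DigitSum.

Theorem theorem2p4 (r : rat) (hr : 0 < r) :
  exists u : nat,
    (0 < digit_sum 2 u)%N /\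
    (digit_sum 2 (u ^ 2)%N)%:R / (digit_sum 2 u)%:R = r.
Proof.
have [a [b [a0 b0 ->]]] : exists a b : nat,
    [/\ (0 < a)%N, (0 < b)%N & r = a%:R / b%:R].
  exists `|numq r|%N, `|denq r|%N; rewrite !absz_gt0 denq_neq0 numq_eq0 gt_eqF //.
  split=> //; rewrite !natr_absz !gtr0_norm ?denq_gt0 ?numq_gt0 //.
  by rewrite divq_num_den.
(* This solves s(u) = k + c + 3 + 2 n = k + 6 a + 2 for [k]; the subtraction does not truncate since
   b >= 1. *)
pose k := (b * (14 * a + 15) - 6 * a - 2)%N.
have [//||t [st stw stt]] := digit_sum2_seed (2 * a - 1) k; try by nia.
have [u [su _ suu]] := digit_sum2_adjoinn (2 * a) t (1 + 2 ^ k).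
have k2 : (2 <= k)%N by nia.
have sw : digit_sum 2 (1 + 2 ^ k) = 2%N.
  rewrite -[(2 ^ k)%N]muln1 digit_sumD ?digit_sum1 //.
  by rewrite -{1}(expn0 2) ltn_exp2l //; lia.
have sww : digit_sum 2 ((1 + 2 ^ k) ^ 2) = 3%N.
  (* With k >= 2 the three powers of two in 1 + 2^(k+1) + 2^(2k) are distinct. *)
  rewrite (_ : _ ^ 2 = 1 + 2 ^ k.+1 * (1 + 2 ^ k.-1 * 1))%N; last first.
    by rewrite -(ltn_predK k2) /= !expnS; ring.
  rewrite !digit_sumD ?digit_sum1 //; rewrite -{1}(expn0 2) ltn_exp2l //; lia.
have binE : 'C((2 * a).+1, 2) = (a * (2 * a + 1))%N.
  by rewrite bin2 /= -[RHS]doubleK -muln2; congr _./2; ring.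
have uE : digit_sum 2 u = (b * (14 * a + 15))%N by rewrite su st sw /k; nia.
have uuE : digit_sum 2 (u ^ 2) = (a * (14 * a + 15))%N.
  by rewrite suu stt stw sww binE; nia.
exists u; rewrite uE uuE; split; first by nia.
by rewrite !natrM -mulf_div divff ?mulr1 // pnatr_eq0; lia.
Qed.
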